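(* Let $s^*\le 1$ and let $F$ be a bi-$s^*$-concave distribution function on $\mathbb{R}$, with $f=F'$ on $J(F)=\{x\in\mathbb{R}:0<F(x)<1\}$ and $f'=F''$ (defined almost everywhere on $J(F)$). Define $$\tilde\gamma(F)=\operatorname*{ess\,sup}_{x\in J(F)}F(x)(1-F(x))\frac{|f'(x)|}{f^2(x)},\qquad \gamma(F)=\operatorname*{ess\,sup}_{x\in J(F)}\min\{F(x),1-F(x)\}\frac{|f'(x)|}{f^2(x)},$$ $$\overline\gamma(F)=\max\left\{\operatorname*{ess\,sup}_{x\in J(F)}\frac{F(x)f'(x)}{f(x)^2},\ \operatorname*{ess\,sup}_{x\in J(F)}\frac{(1-F(x))(-f'(x))}{f(x)^2}\right\}.$$ Then $$\tfrac12\gamma(F)\le\tilde\gamma(F)\le\gamma(F)\le\overline\gamma(F)\le 1-s^*.$$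
   Context: For $s^*\in(-\infty,1]$, a distribution function $F$ on $\mathbb{R}$ is bi-$s^*$-concave if $F$ is continuous on $\mathbb{R}$ and, on $J(F)$: for $s^*<0$, both $F^{s^*}$ and $(1-F)^{s^*}$ are convex; for $s^*=0$, both $\log F$ and $\log(1-F)$ are concave; for $0<s^*\le 1$, both $F^{s^*}$ and $(1-F)^{s^*}$ are concave. For such $F$, it is known that $F$ is differentiable on $J(F)$ with strictly positive derivative $f$, and $f$ is differentiable almost everywhere on $J(F)$, so the quantities in the claim are well defined. Essential suprema are with respect to Lebesgue measure. *)

(* Defs.v *)
From HB Require Import structures.
From mathcomp Require Import all_boot all_order all_algebra.
From mathcomp Require Import all_classical all_reals all_analysis.
From mathcomp Require Import ess_sup_inf.

Set Implicit Arguments.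
Unset Strict Implicit.
Unset Printing Implicit Defensive.

Import Order.TTheory GRing.Theory Num.Theory.
Import numFieldNormedType.Exports.

Local Open Scope classical_set_scope.
Local Open Scope ring_scope.

Definition concave_function (R : realType) (D : set R) (g : R -> R) : Prop :=
  convex_function (E := R^o) D (fun x => - g x).

Definition J (R : realType) (F : R -> R) : set R := [set x | 0 < F x < 1].

Definition bi_concave (R : realType) (s : R) (F : R -> R) : Prop :=
  [/\ continuous F,
      s < 0 -> convex_function (E := R^o) (J F) (fun x => F x `^ s) /\
               convex_function (E := R^o) (J F) (fun x => (1 - F x) `^ s),
      s = 0 -> concave_function (J F) (fun x => ln (F x)) /\
               concave_function (J F) (fun x => ln (1 - F x)) &
      0 < s -> concave_function (J F) (fun x => F x `^ s) /\
               concave_function (J F) (fun x => (1 - F x) `^ s)].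

(* Extending by -oo outside D makes the points outside D irrelevant, so this
   is the essential supremum over D for Lebesgue measure. *)
Definition ess_sup_on (R : realType) (D : set R) (g : R -> R) : \bar R :=
  ess_sup lebesgue_measure (fun x => if x \in D then (g x)%:E else -oo%E).

(* derive1n 2 F is a total function.  For a bi-s-concave F, the points of J F
   where F' is not differentiable form a Lebesgue-null set, so the conventional
   value taken there does not affect the essential suprema. *)
Definition gamma_tilde (R : realType) (F : R -> R) : \bar R :=
  ess_sup_on (J F)
    (fun x => F x * (1 - F x) * (`|derive1n 2 F x| / (derive1 F x) ^+ 2)).

Definition gamma (R : realType) (F : R -> R) : \bar R :=
  ess_sup_on (J F)
    (fun x => Num.min (F x) (1 - F x) * (`|derive1n 2 F x| / (derive1 F x) ^+ 2)).

Definition gamma_bar (R : realType) (F : R -> R) : \bar R :=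
  maxe
    (ess_sup_on (J F) (fun x => F x * derive1n 2 F x / (derive1 F x) ^+ 2))
    (ess_sup_on (J F) (fun x => (1 - F x) * (- derive1n 2 F x) / (derive1 F x) ^+ 2)).

(* Main.v *)
(* Let phi_s(t) = t^s / s (ln t for s = 0), so that phi_s'(t) = t^(s-1) for every
   s; bi-s-concavity says that phi_s(F) and phi_s(1-F) are both concave on J(F).
   At each point, a supporting line of phi_s(F) bounds the slope of F from one
   side and a supporting line of phi_s(1-F) bounds it from the other, whence F
   is differentiable.  Then F^(s-1) f, the derivative of the concave phi_s(F),
   is nonincreasing, and differentiating it wherever f' exists gives
   F f' <= (1-s) f^2; applying this to 1-F gives the bound on -(1-F) f'.  Where
   f' does not exist, its conventional value 0 satisfies both bounds, so the
   almost everywhere differentiability of f is never needed.  The other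
   inequalities hold pointwise between the functions under the suprema, by
   min(u,1-u)/2 <= u(1-u) <= min(u,1-u). *)
Require Import Defs.
From HB Require Import structures.
From mathcomp Require Import all_boot all_order all_algebra.
From mathcomp Require Import all_classical all_reals all_analysis.
From mathcomp Require Import ess_sup_inf ring lra.

Set Implicit Arguments.
Unset Strict Implicit.
Unset Printing Implicit Defensive.

Import Order.TTheory GRing.Theory Num.Theory.
Import numFieldNormedType.Exports.

Local Open Scope classical_set_scope.
Local Open Scope ring_scope.

(** * Derivatives as slope inequalities with small error *)

(** Free of quotients and valid at [y = x], this form lets estimates near [x] be added as linear
    inequalities. *)
Lemma is_derive1_slopeP (R : realType) (f : R -> R) (x l : R) :
  is_derive x 1 f l <->
  forall e, 0 < e -> \forall y \near x, `|f y - f x - l * (y - x)| <= e * `|y - x|.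
Proof.
split=> [[df <-] e e0|H].
  have /cvgrPdist_le/(_ e e0) := df.
  rewrite -/('D_1 f x) near_withinE near_simpl => h0.
  have : y - x @[y --> x] --> (0 : R).
    by rewrite -[X in _ --> X](subrr x); apply: (cvgB cvg_id); exact: cvg_cst.
  move=> /(_ _ h0); apply: (@filterS _ (nbhs x)) => y /=.
  have [->|yx] := eqVneq y x; first by rewrite !subrr mulr0 subrr normr0 mulr0.
  rewrite subr_eq0 => /(_ yx) /=.
  rewrite /shift/= /GRing.scale/= mulr1 subrK => le.
  have yx0 : y - x != 0 by rewrite subr_eq0.
  rewrite -ler_pdivrMr ?normr_gt0// -normfV -normrM mulrBl mulfK//.
  by rewrite distrC mulrC.
suff c : (fun h => h^-1 *: ((f \o shift x) (h *: (1:R)) - f x)) @ 0^' --> l.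
  split; first by apply: cvgP c.
  exact: cvg_lim c.
apply/cvgrPdist_le => e e0; rewrite near_withinE near_simpl.
have := H _ e0 => h0.
have : h + x @[h --> 0] --> x.
  by rewrite -[X in _ --> X](add0r x); apply: (cvgD cvg_id); exact: cvg_cst.
move=> /(_ _ h0); apply: (@filterS _ (nbhs (0:R))) => h /=.
rewrite addrK /shift/= /GRing.scale/= mulr1 => le hn0.
rewrite distrC -(ler_pM2r (_ : 0 < `|h|)) ?normr_gt0// -normrM mulrBl.
by rewrite mulrAC mulVf// mul1r.
Qed.

Lemma le0_of_slope_le_eps (R : realFieldType) (k : R) (x : R) :
  (forall e, 0 < e -> \forall y \near x, x < y -> k * (y - x) <= e * `|y - x|) -> k <= 0.
Proof.
move=> H; apply/ler_addgt0Pr => e e0; rewrite add0r; have := H _ e0.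
case/nbhs_ballP => r /= r0 /(_ (x + r / 2)).
have r20 : 0 < r / 2 by rewrite divr_gt0.
rewrite /ball/= ltrDl r20 opprD addNKr normrN addrAC subrr add0r gtr0_norm//.
have -> : r / 2 < r by lra.
by move=> /(_ isT isT); rewrite ler_pM2r.
Qed.

Lemma eq0_of_slope_le_eps (R : realFieldType) (k : R) (x : R) :
  (forall e, 0 < e -> \forall y \near x, k * (y - x) <= e * `|y - x|) -> k = 0.
Proof.
move=> H; apply/eqP; rewrite eq_le; apply/andP; split.
  by apply: (@le0_of_slope_le_eps _ _ x) => e /H; apply: filterS.
(* The reflection [y] to [- y] turns points left of [x] into points right of [- x]. *)
rewrite -oppr_le0; apply: (@le0_of_slope_le_eps _ _ (- x)) => e /H.
rewrite nearN; apply: filterS => y le _.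
by rewrite -opprD normrN mulrNN.
Qed.

(** * Supporting lines of concave functions *)

Definition supergradient (R : realType) (D : set R) (g : R -> R) (x p : R) :=
  forall y, D y -> g y <= g x + p * (y - x).

Lemma concaveE (R : realType) (D : set R) (g : R -> R) (t a b : R) :
  concave_function D g -> 0 <= t -> t <= 1 -> D a -> D b ->
  t * g a + (1 - t) * g b <= g (t * a + (1 - t) * b).
Proof.
move=> cg t0 t1 Da Db.
have := cg (Itv01 t0 t1) a b (mem_set Da) (mem_set Db).
change (- g (t * a + (1 - t) * b) <= t * - g a + (1 - t) * - g b ->
  t * g a + (1 - t) * g b <= g (t * a + (1 - t) * b)).
lra.
Qed.

Lemma concave_chord (R : realType) (D : set R) (g : R -> R) (a x b : R) :
  concave_function D g -> D a -> D b -> a < x -> x < b ->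
  (b - x) * g a + (x - a) * g b <= (b - a) * g x.
Proof.
move=> cg Da Db ax xb.
have ab : 0 < b - a by rewrite subr_gt0 (lt_trans ax).
have t0 : 0 <= (b - x) / (b - a) by rewrite divr_ge0 ?(ltW ab)// subr_ge0 ltW.
have t1 : (b - x) / (b - a) <= 1 by rewrite ler_pdivrMr// mul1r lerD2l lerN2 ltW.
have := concaveE cg t0 t1 Da Db.
have -> : (b - x) / (b - a) * a + (1 - (b - x) / (b - a)) * b = x.
  by field; rewrite gt_eqF.
have -> : 1 - (b - x) / (b - a) = (x - a) / (b - a) by field; rewrite gt_eqF.
rewrite mulrAC [_ / _ * g b]mulrAC -mulrDl ler_pdivrMr//.
by rewrite [g x * _]mulrC.
Qed.

(** The slope is the supremum of the chord slopes to the right of [x]. By concavity each chord slope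
    to the left bounds them all; openness of [D] supplies points on both sides. *)
Lemma concave_supergradient (R : realType) (D : set R) (g : R -> R) (x : R) :
  open D -> concave_function D g -> D x -> exists p, supergradient D g x p.
Proof.
move=> oD cg Dx.
have [r /= r0 rD] : exists2 r, 0 < r & ball x r `<=` D.
  by have /nbhs_ballP[r /= r0 ?] := open_nbhs_nbhs (conj oD Dx); exists r.
have r20 : 0 < r / 2 by rewrite divr_gt0.
have rr : r / 2 < r by lra.
pose S := [set (g b - g x) / (b - x) | b in [set b | D b /\ x < b]].
have Sub a : D a -> a < x -> ubound S ((g x - g a) / (x - a)).
  move=> Da ax _ [b [Db xb] <-].
  have := concave_chord cg Da Db ax xb.
  rewrite ler_pdivrMr ?subr_gt0// mulrAC ler_pdivlMr ?subr_gt0//; nra.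
have Dl : D (x - r / 2) by apply: rD; rewrite /ball/= opprB addrC subrK ger0_norm ?ltW.
have Dr : D (x + r / 2) by apply: rD; rewrite /ball/= opprD addNKr normrN ger0_norm ?ltW.
have hS : has_sup S.
  split; first by exists ((g (x + r / 2) - g x) / (x + r / 2 - x)), (x + r / 2); split; rewrite ?ltrDl.
  by eexists; apply: Sub Dl _; rewrite gtrBl.
exists (sup S) => y Dy.
have [yx|xy|->] := ltgtP y x; last by rewrite subrr mulr0 addr0.
- have : sup S <= (g x - g y) / (x - y) by apply: ge_sup; [case: hS|exact: Sub].
  by rewrite ler_pdivlMr ?subr_gt0//; nra.
- have : (g y - g x) / (y - x) <= sup S by apply: ub_le_sup; [case: hS|exists y].
  by rewrite ler_pdivrMr ?subr_gt0//; nra.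
Qed.

(** * From one-sided slope bounds to differentiability *)

Lemma is_derive_slope_factor (R : realType) (f : R -> R) (x a d : R) :
  is_derive x 1 f a -> 0 < d ->
  \forall y \near x, exists2 c, `|c - a| <= d & f y - f x = c * (y - x).
Proof.
move=> /is_derive1_slopeP df d0; have := df _ d0; apply: filterS => y le.
have [->|yx] := eqVneq y x; first by exists a; rewrite !subrr ?mulr0// normr0 ltW.
exists ((f y - f x) / (y - x)); last by rewrite divfK ?subr_eq0.
have yx0 : y - x != 0 by rewrite subr_eq0.
by rewrite -(ler_pM2r (_ : 0 < `|y - x|)) ?normr_gt0// -normrM mulrBl divfK.
Qed.

(** Write [phi (U y) - phi (U x) = c * (U y - U x)] with [c] close to [a], hence positive. Dividing
    by [c] bounds [U y - U x] whatever its sign, and [p / c] is close to [p / a]. *)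
Lemma upper_slope_of_comp (R : realType) (phi U : R -> R) (x a p e : R) :
  {for x, continuous U} -> is_derive (U x) 1 phi a -> 0 < a ->
  (\forall y \near x, phi (U y) <= phi (U x) + p * (y - x)) -> 0 < e ->
  \forall y \near x, U y - U x <= p / a * (y - x) + e * `|y - x|.
Proof.
move=> cU dphi a0 H e0.
have [d d0 Hd] : exists2 d, 0 < d & forall c, `|c - a| <= d -> 0 < c /\ `|p / c - p / a| <= e.
  have : \forall c \near a, 0 < c /\ `|p / c - p / a| <= e.
    near=> c; split; first by near: c; exact: lt_nbhsr.
    near: c; rewrite -/(nbhs _ _).
    have /cvgrPdist_le/(_ _ e0) : p / c @[c --> a] --> p / a.
      by apply: cvgM; [exact: cvg_cst|apply: cvgV; [rewrite gt_eqF|exact: cvg_id]].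
    by apply: filterS => c; rewrite distrC.
  case/nbhs_ballP => r /= r0 Hr; exists (r / 2); first by rewrite divr_gt0.
  move=> c ca; apply: Hr; rewrite /ball/= distrC (le_lt_trans ca)//.
  by rewrite ltr_pdivrMr// ltr_pMr// ltr1n.
have := is_derive_slope_factor dphi d0; move=> /cU.
apply: (@filterS2 _ (nbhs x) _ _ _ _ _ H) => y le [c /Hd[c0 pc] E].
have {}le : c * (U y - U x) <= p * (y - x) by lra.
have : U y - U x <= p / c * (y - x) by rewrite mulrAC ler_pdivlMr// mulrC.
have := ler_norm ((p / c - p / a) * (y - x)); rewrite normrM.
have := ler_wpM2r (normr_ge0 (y - x)) pc; lra.
Unshelve. all: by end_near. Qed.

(** Adding the two bounds, with error [e / 2] each, forces [n = - m]; the second then bounds the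
    slope from below by the same [m]. *)
Lemma is_derive_of_dual_upper_slopes (R : realType) (U : R -> R) (x m n : R) :
  (forall e, 0 < e -> \forall y \near x, U y - U x <= m * (y - x) + e * `|y - x|) ->
  (forall e, 0 < e -> \forall y \near x, U x - U y <= n * (y - x) + e * `|y - x|) ->
  is_derive x 1 U m.
Proof.
move=> up lo.
have nm : - m - n = 0.
  apply: (@eq0_of_slope_le_eps _ _ x) => e e0.
  have e20 : 0 < e / 2 by rewrite divr_gt0.
  have := lo _ e20; have := up _ e20; apply: filterS2 => y; lra.
have {nm} nE : n = - m by lra.
rewrite nE in lo; apply/is_derive1_slopeP => e e0.
have := lo _ e0; have := up _ e0; apply: filterS2 => y h1 h2.
by rewrite ler_norml; lra.
Qed.

Lemma convex_function_scale (R : realType) (D : set R) (f : R -> R) (k : R) :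
  0 <= k -> convex_function (E := R^o) D f ->
  convex_function (E := R^o) D (fun x => k * f x).
Proof.
move=> k0 cf t x y xD yD; have := ler_wpM2l k0 (cf t x y xD yD).
congr (_ <= _); rewrite !convRE; ring.
Qed.

(** * Concavity after the transformation [phi_s] *)

Definition powR_primitive (R : realType) (s t : R) : R :=
  if s == 0 then ln t else s^-1 * t `^ s.

Lemma is_derive_powR_primitive (R : realType) (s t : R) :
  0 < t -> is_derive t 1 (powR_primitive s) (t `^ (s - 1)).
Proof.
move=> t0; rewrite /powR_primitive; have [->|s0] := eqVneq s 0.
  by rewrite sub0r powR_inv1 ?ltW//; exact: is_derive1_ln.
apply: is_derive_eq; first exact: (is_deriveZ s^-1 (is_derive1_powR s t0)).
by rewrite /GRing.scale/= mulKf.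
Qed.

(** The factor [s^-1] has the sign of [s], so for negative [s] it turns convexity into concavity and
    the three cases merge. *)
Lemma bi_concave_powR_primitive (R : realType) (s : R) (F : R -> R) :
  bi_concave s F ->
  concave_function (J F) (fun x => powR_primitive s (F x)) /\
  concave_function (J F) (fun x => powR_primitive s (1 - F x)).
Proof.
move=> [_ neg zero pos]; rewrite /powR_primitive /concave_function.
have [s0|s0|s0] := ltgtP s 0; last by have := zero s0.
- have [c1 c2] := neg s0; have k0 : 0 <= - s^-1 by rewrite oppr_ge0 invr_le0 ltW.
  by split; under eq_fun do rewrite -mulNr; exact: convex_function_scale.
- have [c1 c2] := pos s0; have k0 : 0 <= s^-1 by rewrite invr_ge0 ltW.
  by split; under eq_fun do rewrite -mulrN; exact: convex_function_scale.
Qed.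

(** Comparing the supporting line with the tangent bounds [(l - p) * (y - x)] by a small multiple of
    the distance, on both sides of [x]. *)
Lemma supergradient_derivable (R : realType) (D : set R) (g : R -> R) (x p l : R) :
  open D -> D x -> supergradient D g x p -> is_derive x 1 g l -> p = l.
Proof.
move=> oD Dx gp /is_derive1_slopeP gl.
suff : l - p = 0 by lra.
apply: (@eq0_of_slope_le_eps _ _ x) => e /gl.
apply: (@filterS2 _ (nbhs x) _ D) (open_nbhs_nbhs (conj oD Dx)) => y Dy.
by have := gp _ Dy; rewrite ler_norml; lra.
Qed.

(** Add the supporting-line inequalities at [x] and at [y], each evaluated at the other point. *)
Lemma concave_derive_anti (R : realType) (D : set R) (g w : R -> R) (x y : R) :
  open D -> concave_function D g -> (forall z, D z -> is_derive z 1 g (w z)) ->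
  D x -> D y -> x < y -> w y <= w x.
Proof.
move=> oD cg gw Dx Dy xy.
have sup z : D z -> supergradient D g z (w z).
  move=> Dz; have [p gp] := concave_supergradient oD cg Dz.
  by rewrite -(supergradient_derivable oD Dz gp (gw _ Dz)).
have := sup _ Dx _ Dy; have := sup _ Dy _ Dx.
by rewrite -subr_gt0 in xy => h1 h2; rewrite -subr_ge0 -(pmulr_lge0 _ xy); lra.
Qed.

Lemma second_order_powR_concave (R : realType) (s : R) (D : set R)
    (U u : R -> R) (x u2 : R) :
  open D -> (forall y, D y -> 0 < U y) ->
  (forall y, D y -> is_derive y 1 U (u y)) ->
  concave_function D (fun y => powR_primitive s (U y)) ->
  D x -> is_derive x 1 u u2 ->
  U x * u2 <= (1 - s) * u x ^+ 2.
Proof.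
move=> oD U0 dU cU Dx du.
pose w y := U y `^ (s - 1) * u y.
have dw y : D y -> is_derive y 1 (fun y => powR_primitive s (U y)) (w y).
  by move=> Dy; exact: (is_derive1_comp (is_derive_powR_primitive s (U0 _ Dy)) (dU _ Dy)).
pose w2 := U x `^ (s - 1) * u2 + u x * (u x * ((s - 1) * U x `^ (s - 2))).
have dwx : is_derive x 1 w w2.
  have dp := is_derive1_powR (s - 1) (U0 _ Dx).
  have dc := is_derive1_comp dp (dU _ Dx).
  have dm : is_derive x 1 w _ := is_deriveM dc du.
  apply: (is_derive_eq dm).
  by rewrite /w2 /GRing.scale/= (_ : s - 1 - 1 = s - 2); ring.
have : w2 <= 0.
  apply: (@le0_of_slope_le_eps _ _ x) => e.
  have /is_derive1_slopeP/[apply] := dwx.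
  apply: (@filterS2 _ (nbhs x) _ D) (open_nbhs_nbhs (conj oD Dx)) => y Dy le xy.
  have := concave_derive_anti oD cU dw Dx Dy xy.
  by move: le; rewrite ler_norml; lra.
(* Factoring out this power, [w2] is [U x] to the power [s - 2] times
   [U x * u2 - (1 - s) * u x ^+ 2]. *)
have Us : U x `^ (s - 1) = U x * U x `^ (s - 2).
  rewrite (_ : s - 1 = 1 + (s - 2)); last by ring.
  have Ux0 := U0 _ Dx.
  by rewrite [LHS]powRD ?powRr1 ?(ltW Ux0)// lt0r_neq0 ?implybT.
have P0 : 0 < U x `^ (s - 2) by rewrite powR_gt0// U0.
rewrite /w2 Us => w2le; rewrite -subr_ge0 -(pmulr_lge0 _ P0); lra.
Qed.

Lemma open_J (R : realType) (F : R -> R) : continuous F -> open (J F).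
Proof.
move=> cF; rewrite (_ : J F = F @^-1` `]0, 1[).
  by apply: open_comp => [x _|]; [exact: cF|exact: itv_open].
by apply/seteqP; split=> x /=; rewrite in_itv.
Qed.

Lemma concave_comp_upper_slope (R : realType) (s : R) (D : set R) (U : R -> R) (x : R) :
  open D -> D x -> 0 < U x -> {for x, continuous U} ->
  concave_function D (fun y => powR_primitive s (U y)) ->
  exists m, forall e, 0 < e ->
    \forall y \near x, U y - U x <= m * (y - x) + e * `|y - x|.
Proof.
move=> oD Dx U0 cU cc; have [p gp] := concave_supergradient oD cc Dx.
exists (p / (U x `^ (s - 1))) => e; apply: upper_slope_of_comp => //.
- exact: is_derive_powR_primitive.
- exact: powR_gt0.
- by apply: filterS (open_nbhs_nbhs (conj oD Dx)) => y; exact: gp.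
Qed.

Lemma bi_concave_derivable (R : realType) (s : R) (F : R -> R) (x : R) :
  bi_concave s F -> J F x -> derivable F x 1.
Proof.
move=> hF Jx; have [c1 c2] := bi_concave_powR_primitive hF.
have [cF _ _ _] := hF; have oJ := open_J cF.
have /andP[F0 F1] := Jx.
have [m up] := concave_comp_upper_slope oJ Jx F0 (cF x) c1.
have [| |n lo] := concave_comp_upper_slope oJ Jx _ _ c2.
- by rewrite subr_gt0.
- by apply: cvgB; [exact: cvg_cst|exact: cF].
have [] // := @is_derive_of_dual_upper_slopes _ F x m n up.
(* An upper slope bound for [1 - F] is a lower one for [F]. *)
by move=> e /lo; apply: filterS => y; lra.
Qed.

(* [lim] of a divergent filter is [point], which is 0 in R. *)
Lemma derive1_dvg (R : realType) (f : R -> R) (x : R) :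
  ~ derivable f x 1 -> derive1 f x = 0.
Proof. by move=> nd; rewrite derive1E /derive (dvgP nd). Qed.

Lemma bi_concave_second_order (R : realType) (s : R) (F : R -> R) (x : R) :
  s <= 1 -> bi_concave s F -> J F x ->
  F x * derive1n 2 F x <= (1 - s) * derive1 F x ^+ 2 /\
  (1 - F x) * - derive1n 2 F x <= (1 - s) * derive1 F x ^+ 2.
Proof.
move=> s1 hF Jx; rewrite derive1nS derive1n1.
have [d2|/derive1_dvg ->] := pselect (derivable (derive1 F) x 1); last first.
  by rewrite oppr0 !mulr0 mulr_ge0 ?sqr_ge0 ?subr_ge0.
have [c1 c2] := bi_concave_powR_primitive hF.
have oJ : open (J F) by apply: open_J; case: hF.
have dF y : J F y -> is_derive y 1 F (derive1 F y).
  by move=> Jy; rewrite derive1E; exact/derivableP/(bi_concave_derivable hF).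
have ddF : is_derive x 1 (derive1 F) (derive1 (derive1 F) x) by rewrite derive1E; exact/derivableP.
split.
  by apply: (second_order_powR_concave oJ _ dF c1 Jx ddF) => y /andP[].
(* The derivative of [1 - F] is [- derive1 F], with the same square. *)
rewrite -(sqrrN (derive1 F x)).
have dF' y : J F y -> is_derive y 1 (fun y => 1 - F y) (- derive1 F y).
  move=> Jy; have d := is_deriveB (is_derive_cst (1 : R) y 1) (dF _ Jy).
  by apply: (is_derive_eq d); exact: sub0r.
apply: (second_order_powR_concave oJ _ dF' c2 Jx (is_deriveN ddF)) => y /andP[_].
by rewrite subr_gt0.
Qed.

(** * Comparison of essential suprema *)

Lemma le_ess_sup_on (R : realType) (D : set R) (g h : R -> R) :
  (forall x, D x -> g x <= h x) -> (ess_sup_on D g <= ess_sup_on D h)%E.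
Proof.
move=> gh; apply: le_ess_sup; apply: aeW => x.
by case: ifPn => // /set_mem Dx; rewrite lee_fin gh.
Qed.

Lemma ess_sup_on_le_cst (R : realType) (D : set R) (g : R -> R) (c : R) :
  (forall x, D x -> g x <= c) -> (ess_sup_on D g <= c%:E)%E.
Proof.
move=> gc; apply/ess_supP; apply: aeW => x.
by case: ifPn => [/set_mem Dx|_]; rewrite ?lee_fin ?gc ?leNye.
Qed.

(** Almost everywhere [h1] and [h2] both lie below their own essential suprema, as two conull sets
    meet in a conull set. *)
Lemma ess_sup_on_le_max (R : realType) (D : set R) (g h1 h2 : R -> R) :
  (forall x, D x -> g x <= Num.max (h1 x) (h2 x)) ->
  (ess_sup_on D g <= maxe (ess_sup_on D h1) (ess_sup_on D h2))%E.
Proof.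
move=> gh; apply/ess_supP.
have := ess_sup_ge lebesgue_measure (fun x => if x \in D then (h1 x)%:E else -oo%E).
have := ess_sup_ge lebesgue_measure (fun x => if x \in D then (h2 x)%:E else -oo%E).
apply: filterS2 => x; rewrite -!/(ess_sup_on _ _).
case: ifPn => [/set_mem Dx le2 le1|_ _ _]; last exact: leNye.
by apply: (@le_trans _ _ (Num.max (h1 x) (h2 x))%:E); rewrite ?lee_fin ?gh// EFin_max le_max2.
Qed.

Lemma ess_sup_onZ (R : realType) (D : set R) (g : R -> R) (k : R) : 0 < k ->
  (k%:E * ess_sup_on D g)%E = ess_sup_on D (fun x => k * g x).
Proof.
move=> k0; rewrite /ess_sup_on -ess_sup_pZl//; congr (ess_sup _ _).
apply/funext => x /=; case: ifPn => _; first by rewrite EFinM.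
(* Positivity of [k] preserves the value [-oo] outside [D]. *)
by rewrite gt0_muleNy.
Qed.

Theorem corollary4 (R : realType) (s : R) (F : cumulativeBounded (0 : R) (1 : R))
    (s_le1 : s <= 1) (hF : bi_concave s F) :
  [/\ ((2^-1)%:E * gamma F <= gamma_tilde F)%E,
      (gamma_tilde F <= gamma F)%E,
      (gamma F <= gamma_bar F)%E &
      (gamma_bar F <= (1 - s)%:E)%E].
Proof.
split.
- rewrite ess_sup_onZ ?invr_gt0//; apply: le_ess_sup_on => x /andP[F0 F1].
  rewrite mulrA; apply: ler_wpM2r; first by rewrite divr_ge0 ?sqr_ge0.
  (* The larger of [F x] and [1 - F x] is at least one half. *)
  by rewrite /Num.min; case: ifPn => h; nra.
- apply: le_ess_sup_on => x /andP[F0 F1].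
  apply: ler_wpM2r; first by rewrite divr_ge0 ?sqr_ge0.
  by rewrite le_min; apply/andP; split; nra.
- apply: ess_sup_on_le_max => x /andP[F0 F1]; rewrite le_max.
  have i0 : 0 <= (derive1 F x ^+ 2)^-1 by rewrite invr_ge0 sqr_ge0.
  (* The sign of the second derivative selects the term of [gamma_bar]; the minimum is at most
     either factor. *)
  rewrite !mulrA; have [f0|f0] := leP 0 (derive1n 2 F x); apply/orP; [left|right].
    by rewrite ger0_norm// !ler_wpM2r// ge_min lexx.
  have d0 : 0 <= - derive1n 2 F x by rewrite oppr_ge0 ltW.
  by rewrite ltr0_norm// !ler_wpM2r// ge_min lexx orbT.
- rewrite ge_max; apply/andP; split; apply: ess_sup_on_le_cst => x Jx;
    have [b1 b2] := bi_concave_second_order s_le1 hF Jx;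
    (* If the derivative is 0, the quotient is 0 since [0^-1 = 0], and [1 - s] is nonnegative. *)
    have := sqr_ge0 (derive1 F x); rewrite le_eqVlt => /predU1P[<-|f0];
    by rewrite ?invr0 ?mulr0 ?subr_ge0// ler_pdivrMr.
Qed.
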